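(* Let $TG$ be a type graph, $T$ a finite graph typed over $TG$, and $c$ a nested condition in $\mathbf{Graph}_{\mathbf{TG}}$ over some graph $C_0$. Then, for every graph $S\in\mathbf{Sub}(T)$ and every injective morphism $g\colon C_0\hookrightarrow S$ (in $\mathbf{Graph}_{\mathbf{TG}}$), $$g\models c\iff g_{\mathrm m}\models_{\mathcal I}\mathrm{Inst}(c,\mu_g^{T},\mathbf{Sub}(T)),$$ where $\mu_g=(g_{\mathrm e},g_{\mathrm m})$ is the instantiation of $C_0$ in $S$ that corresponds to $g$ and $\mu_g^{T}$ is the corresponding instantiation of $C_0$ in $T$.
   Context: **Graphs.** A graph $G=(V_G,E_G,\mathit{src}_G,\mathit{tar}_G)$ consists of a set of nodes, a set of edges, and source and target functions $E_G\to V_G$; graph morphisms are pairs of functions on nodes and edges compatible with source and target. A type graph $TG$ is a fixed graph; a graph typed over $TG$ is a graph $G$ with a graph morphism $\mathit{type}_G\colon G\to TG$; typed morphisms $f\colon G\to H$ satisfy $\mathit{type}_H\circ f=\mathit{type}_G$. $\mathbf{Graph}_{\mathbf{TG}}$ is the category of graphs typed over $TG$ with typed morphisms (all graphs and morphisms below are typed over $TG$); its monomorphisms are the injective morphisms, written $\hookrightarrow$. A graph is finite if its node and edge sets are. A subgraph $H\subseteq G$ has $V_H\subseteq V_G$, $E_H\subseteq E_G$ with $\mathit{src}_H,\mathit{tar}_H,\mathit{type}_H$ the restrictions of those of $G$. $\mathbf{Sub}(T)$ is the category whose objects are the subgraphs of $T$ and whose morphisms are the inclusions between them; $\iota^A_B\colon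 A\subseteq B$ denotes an inclusion. **Nested conditions.** In a category $\mathcal D$ (here $\mathbf{Graph}_{\mathbf{TG}}$ or $\mathbf{Sub}(T)$), conditions over an object $C_0$ are defined recursively: $\mathsf{true}$ is a condition over $C_0$; if $a_1\colon C_0\hookrightarrow C_1$ is a monomorphism and $d$ a condition over $C_1$, then $\exists\,(a_1\colon C_0\hookrightarrow C_1,d)$ is a condition over $C_0$; (finite) Boolean combinations (via $\neg,\wedge,\vee$) of conditions over $C_0$ are conditions over $C_0$. $\mathsf{false}:=\neg\mathsf{true}$. Satisfaction by a morphism $g\colon C_0\to G$: every morphism satisfies $\mathsf{true}$; $g$ satisfies $\exists\,(a_1\colon C_0\hookrightarrow C_1,d)$ iff there is a monomorphism $q\colon C_1\hookrightarrow G$ with $g=q\circ a_1$ and $q$ satisfies $d$; Boolean operators as usual. Satisfaction in $\mathbf{Graph}_{\mathbf{TG}}$ is denoted $\models$, satisfaction in $\mathbf{Sub}(T)$ (where all morphisms are inclusions) is denoted $\models_{\mathcal I}$. **Instantiations.** An instantiation $\mu=(j,\iota^B_S)$ of a graph $C$ from $\mathbf{Graph}_{\mathbf{TG}}$ in $S\in\mathbf{Sub}(T)$ consists of an isomorphism $j\colon C\to B$ with $B\subseteq S$ and the inclusion $\iota^B_S\colon B\subseteq S$. An instantiation in $S$ of a morphism $a\colon C_0\to C_1$ is a morphism $b\colon B_0\subseteq B_1$ between the images of instantiations $\mu_0=(j_0,\iota^{B_0}_S)$ of $C_0$ and $\mu_1=(j_1,\iota^{B_1}_S)$ of $C_1$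 such that $b\circ j_0=j_1\circ a$ and $\iota^{B_1}_S\circ b=\iota^{B_0}_S$; $\mu_0$ is called its domain and $\mu_1$ its codomain. Instantiations in $T$ are called instantiations in $\mathbf{Sub}(T)$. An injective morphism $g\colon C_0\hookrightarrow S$ corresponds to the instantiation $\mu_g=(g_{\mathrm e},g_{\mathrm m})$ given by its image factorization $g=g_{\mathrm m}\circ g_{\mathrm e}$, with $g_{\mathrm e}\colon C_0\to\mathrm{Im}\,g$ an isomorphism onto the subgraph $\mathrm{Im}\,g\subseteq S$ and $g_{\mathrm m}\colon\mathrm{Im}\,g\subseteq S$ the inclusion; $\mu_g^T=(g_{\mathrm e},\iota^S_T\circ g_{\mathrm m})$ is the corresponding instantiation in $T$. **Instantiating conditions.** Let $c$ be a condition over $C_0$ in $\mathbf{Graph}_{\mathbf{TG}}$ and $\mu_0=(j\colon C_0\to B_0,\iota^{B_0}_T)$ an instantiation of $C_0$ in $\mathbf{Sub}(T)$. The condition $\mathrm{Inst}(c,\mu_0,\mathbf{Sub}(T))$ over $B_0$ in $\mathbf{Sub}(T)$ is defined recursively (writing $\mathrm{Inst}(c,\mu_0)$ for short): - $\mathrm{Inst}(\mathsf{true},\mu_0)=\mathsf{true}$; - $\mathrm{Inst}(d_1\odot d_2,\mu_0)=\mathrm{Inst}(d_1,\mu_0)\odot\mathrm{Inst}(d_2,\mu_0)$; - $\mathrm{Inst}(\exists\,(a_1\colon C_0\hookrightarrow C_1,d),\mu_0)=\bigvee_{b_1\in\mathcal J}\exists\,(b_1\colon B_0\subseteq B_1,\mathrm{Inst}(d,\mu_1))$;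 - $\mathrm{Inst}(\neg\mathsf{true},\mu_0)=\mathsf{false}$; - $\mathrm{Inst}(\neg(e_1\odot e_2),\mu_0)=\mathrm{Inst}(\neg e_1,\mu_0)\,\overline\odot\,\mathrm{Inst}(\neg e_2,\mu_0)$; - $\mathrm{Inst}(\neg\neg e,\mu_0)=\mathrm{Inst}(e,\mu_0)$; - $\mathrm{Inst}(\neg\exists\,(a_1\colon C_0\hookrightarrow C_1,e),\mu_0)=\bigwedge_{b_1\in\mathcal J}\big(\neg\exists\,(b_1\colon B_0\subseteq B_1,\mathsf{true})\vee\exists\,(b_1\colon B_0\subseteq B_1,\mathrm{Inst}(\neg e,\mu_1))\big)$. Here $\odot\in\{\wedge,\vee\}$, $\overline\wedge=\vee$, $\overline\vee=\wedge$; $\mathcal J$ indexes all instantiations of $a_1$ with domain $\mu_0$ in $\mathbf{Sub}(T)$, and $\mu_1$ (with image $B_1$) denotes the respective codomain, an instantiation of $C_1$ (so there is one index for each such $\mu_1$); the empty disjunction is $\mathsf{false}$ and the empty conjunction is $\mathsf{true}$. *)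

(* Defs.v *)
From mathcomp Require Import all_boot finmap.
From mathcomp Require Import all_classical.

Set Implicit Arguments.
Unset Strict Implicit.
Unset Printing Implicit Defensive.

Local Open Scope classical_set_scope.

Record category := Category {
  ob :> Type;
  hom : ob -> ob -> Type;
  idm : forall A, hom A A;
  cmp : forall A B C, hom B C -> hom A B -> hom A C;
  cmp_idl : forall A B (f : hom A B), cmp (idm B) f = f;
  cmp_idr : forall A B (f : hom A B), cmp f (idm A) = f;
  cmp_assoc : forall A B C D (h : hom C D) (g : hom B C) (f : hom A B),
    cmp h (cmp g f) = cmp (cmp h g) f
}.
Arguments hom {c} _ _.
Arguments idm {c} _.
Arguments cmp {c A B C} _ _.

Definition mono (D : category) (A B : D) (f : hom A B) : Prop :=
  forall (X : D) (u v : hom X A), cmp f u = cmp f v -> u = v.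

Definition iso (D : category) (A B : D) (f : hom A B) : Prop :=
  exists2 k : hom B A, cmp k f = idm A & cmp f k = idm B.

Inductive cond (D : category) : D -> Type :=
| CTrue C0 : cond C0
| CEx C0 C1 (a1 : hom C0 C1) (a1_mono : mono a1) (d : cond C1) : cond C0
| CNot C0 (d : cond C0) : cond C0
| CAnd C0 (d1 d2 : cond C0) : cond C0
| COr C0 (d1 d2 : cond C0) : cond C0.
Arguments CTrue {D C0}.
Arguments CEx {D C0 C1} a1 a1_mono d.
Arguments CNot {D C0} d.
Arguments CAnd {D C0} d1 d2.
Arguments COr {D C0} d1 d2.

Definition CFalse {D : category} {C0 : D} : cond C0 := CNot CTrue.

Fixpoint sat (D : category) (C0 : D) (c : cond C0) (G : D) :
    hom C0 G -> Prop :=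
  match c in cond C return hom C G -> Prop with
  | CTrue _ => fun=> True
  | CEx _ _ a1 _ d => fun g =>
      exists q : hom _ G, [/\ mono q, g = cmp q a1 & sat d q]
  | CNot _ d => fun g => ~ sat d g
  | CAnd _ d1 d2 => fun g => sat d1 g /\ sat d2 g
  | COr _ d1 d2 => fun g => sat d1 g \/ sat d2 g
  end.

Record graph := Graph {
  node : Type;
  edge : Type;
  src : edge -> node;
  tar : edge -> node
}.

Definition finite_graph (G : graph) : Prop :=
  finite_set [set: node G] /\ finite_set [set: edge G].

Record gmor (G H : graph) := GMor {
  nmap : node G -> node H;
  emap : edge G -> edge H;
  gmor_src : forall e, nmap (src e) = src (emap e);
  gmor_tar : forall e, nmap (tar e) = tar (emap e)
}.

Lemma gmor_eq (G H : graph) (f g : gmor G H) :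
  nmap f =1 nmap g -> emap f =1 emap g -> f = g.
Proof.
case: f g => [fn fe fs ft] [gn ge gs gt] /= /funext En /funext Ee.
by subst; congr GMor; apply: Prop_irrelevance.
Qed.

Definition gid (G : graph) : gmor G G :=
  @GMor G G id id (fun=> erefl) (fun=> erefl).

Program Definition gcmp (A B C : graph) (g : gmor B C) (f : gmor A B) :
    gmor A C :=
  @GMor A C (nmap g \o nmap f) (emap g \o emap f) _ _.
Next Obligation. by move=> A B C g f e; rewrite /= !gmor_src. Qed.
Next Obligation. by move=> A B C g f e; rewrite /= !gmor_tar. Qed.

Record tgraph (TG : graph) := TGraph {
  tgraph_graph :> graph;
  typ : gmor tgraph_graph TG
}.

Record tmor (TG : graph) (G H : tgraph TG) := TMor {
  tmor_gmor :> gmor G H;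
  tmor_typ : gcmp (typ H) tmor_gmor = typ G
}.

Lemma tmor_eq (TG : graph) (G H : tgraph TG) (f g : tmor G H) :
  nmap f =1 nmap g -> emap f =1 emap g -> f = g.
Proof.
case: f g => [f ft] [g gt] /= En Ee; have Efg := gmor_eq En Ee.
by subst; congr TMor; apply: Prop_irrelevance.
Qed.

Definition tid (TG : graph) (G : tgraph TG) : tmor G G :=
  @TMor TG G G (gid G)
    (@gmor_eq _ _ (gcmp (typ G) (gid G)) (typ G) (fun=> erefl) (fun=> erefl)).

Program Definition tcmp (TG : graph) (A B C : tgraph TG)
    (g : tmor B C) (f : tmor A B) : tmor A C :=
  @TMor TG A C (gcmp g f) _.
Next Obligation.
move=> TG A B C g f; rewrite -(tmor_typ f) -(tmor_typ g).
exact: gmor_eq.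
Qed.

Program Definition GraphTG (TG : graph) : category :=
  @Category (tgraph TG) (@tmor TG) (@tid TG) (@tcmp TG) _ _ _.
Next Obligation. by move=> *; apply: tmor_eq. Qed.
Next Obligation. by move=> *; apply: tmor_eq. Qed.
Next Obligation. by move=> *; apply: tmor_eq. Qed.

Definition gmor_injective (G H : graph) (f : gmor G H) : Prop :=
  injective (nmap f) /\ injective (emap f).

Lemma monoE (TG : graph) (G H : GraphTG TG) (f : hom G H) :
  mono f <-> gmor_injective (f : tmor G H).
Proof.
split=> [fm|[fn fe] X u v fuv]; last first.
  apply: tmor_eq => x.
  - by apply: fn; have := congr1 (fun h : tmor X H => nmap h x) fuv.
  - by apply: fe; have := congr1 (fun h : tmor X H => emap h x) fuv.
have typn x : nmap (typ H) (nmap (f : tmor G H) x) = nmap (typ G) x.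
  by rewrite -(tmor_typ (f : tmor G H)).
have type x : emap (typ H) (emap (f : tmor G H) x) = emap (typ G) x.
  by rewrite -(tmor_typ (f : tmor G H)).
have fn : injective (nmap (f : tmor G H)).
  move=> x y fxy.
  pose P := @Graph unit void (of_void _) (of_void _).
  have void_all (K : void -> Prop) : forall e, K e by case.
  pose tP : gmor P TG :=
    @GMor P TG (fun=> nmap (typ G) x) (of_void _) (void_all _) (void_all _).
  pose pt z : gmor P G :=
    @GMor P G (fun=> z) (of_void _) (void_all _) (void_all _).
  have ptx : gcmp (typ G) (pt x) = tP by apply: gmor_eq => [[]|[]].
  have pty : gcmp (typ G) (pt y) = tP.
    by apply: gmor_eq => [[]|[]] /=; rewrite -!typn fxy.
  have := fm (TGraph tP) (@TMor _ (TGraph tP) G _ ptx)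
             (@TMor _ (TGraph tP) G _ pty).
  have E : tcmp f (@TMor _ (TGraph tP) G _ ptx)
         = tcmp f (@TMor _ (TGraph tP) G _ pty).
    by apply: tmor_eq => [[]|[]] /=.
  by move=> /(_ E) /(congr1 (fun h : tmor (TGraph tP) G => nmap h tt)).
split=> // x y fxy.
pose P := @Graph bool unit (fun=> false) (fun=> true).
have sxy : src x = src y by apply: fn; rewrite !gmor_src fxy.
have txy : tar x = tar y by apply: fn; rewrite !gmor_tar fxy.
pose pt z : gmor P G :=
  @GMor P G (fun b => if b then tar z else src z) (fun=> z)
    (fun=> erefl) (fun=> erefl).
pose tP := gcmp (typ G) (pt x).
have pty : gcmp (typ G) (pt y) = tP.
  by apply: gmor_eq => //= [[]|_] /=; rewrite ?sxy ?txy // -!type fxy.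
have := fm (TGraph tP) (@TMor _ (TGraph tP) G (pt x) erefl)
           (@TMor _ (TGraph tP) G _ pty).
have E : tcmp f (@TMor _ (TGraph tP) G (pt x) erefl)
       = tcmp f (@TMor _ (TGraph tP) G _ pty).
  by apply: tmor_eq => [[]|_] /=; rewrite ?sxy ?txy.
by move=> /(_ E) /(congr1 (fun h : tmor (TGraph tP) G => emap h tt)).
Qed.

Record subgraph (TG : graph) (T : tgraph TG) := Subgraph {
  snode : set (node T);
  sedge : set (edge T);
  sub_src : forall e, sedge e -> snode (src e);
  sub_tar : forall e, sedge e -> snode (tar e)
}.

Lemma subgraph_eq (TG : graph) (T : tgraph TG) (A B : subgraph T) :
  snode A = snode B -> sedge A = sedge B -> A = B.
Proof.
case: A B => [An Ae As At] [Bn Be Bs Bt] /= En Ee.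
by subst; congr Subgraph; apply: Prop_irrelevance.
Qed.

Section SubgraphAsGraph.
Variables (TG : graph) (T : tgraph TG) (A : subgraph T).

Definition subgraph_graph : graph :=
  @Graph (snode A) (sedge A)
    (fun e => exist _ (src (val e)) (mem_set (sub_src (set_mem (valP e)))))
    (fun e => exist _ (tar (val e)) (mem_set (sub_tar (set_mem (valP e))))).

Definition subgraph_val : gmor subgraph_graph T :=
  @GMor subgraph_graph T val val (fun=> erefl) (fun=> erefl).

Definition subgraph_tgraph : tgraph TG :=
  @TGraph TG subgraph_graph (gcmp (typ T) subgraph_val).

End SubgraphAsGraph.
Coercion subgraph_tgraph : subgraph >-> tgraph.

Definition whole (TG : graph) (T : tgraph TG) : subgraph T :=
  @Subgraph TG T setT setT (fun _ _ => I) (fun _ _ => I).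

Section Sub.
Variables (TG : graph) (T : tgraph TG).
Implicit Types A B C : subgraph T.

Definition subg A B : Prop := snode A `<=` snode B /\ sedge A `<=` sedge B.

Lemma subg_refl A : subg A A.
Proof. by split. Qed.

Lemma subg_trans A B C : subg B C -> subg A B -> subg A C.
Proof.
by move=> [BCn BCe] [ABn ABe]; split; [apply: subset_trans BCn|
                                         apply: subset_trans BCe].
Qed.

Lemma subg_whole A : subg A (whole T).
Proof. by split. Qed.

Definition Sub : category :=
  @Category (subgraph T) subg subg_refl subg_trans
    (fun A B f => Prop_irrelevance _ _) (fun A B f => Prop_irrelevance _ _)
    (fun A B C D h g f => Prop_irrelevance _ _).

Lemma Sub_mono (A B : Sub) (f : hom A B) : mono f.
Proof. by move=> X u v _; exact: (@Prop_irrelevance (subg X A) u v). Qed.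

Program Definition incl A B (AB : @hom Sub A B) : tmor A B :=
  @TMor TG A B
    (@GMor A B
      (fun x => exist _ (val x) (mem_set (proj1 AB _ (set_mem (valP x)))))
      (fun e => exist _ (val e) (mem_set (proj2 AB _ (set_mem (valP e)))))
      _ _) _.
Next Obligation. by move=> A B AB e; apply: val_inj. Qed.
Next Obligation. by move=> A B AB e; apply: val_inj. Qed.
Next Obligation. by move=> A B AB; apply: gmor_eq. Qed.

End Sub.

Arguments Sub_mono {TG T A B} f _ _ _ _.

Record instantiation (TG : graph) (T : tgraph TG) (C : tgraph TG)
    (S : subgraph T) := Instantiation {
  inst_im : subgraph T;
  inst_j : tmor C inst_im;
  inst_iso : @iso (GraphTG TG) C inst_im inst_j;
  inst_incl : @hom (Sub T) inst_im S
}.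

Definition inst_whole (TG : graph) (T : tgraph TG) (C : tgraph TG)
    (S : subgraph T) (mu : instantiation C S) : instantiation C (whole T) :=
  @Instantiation TG T C (whole T) (inst_im mu) (inst_j mu) (inst_iso mu)
    (@cmp (Sub T) _ _ _ (subg_whole S) (inst_incl mu)).

Record mor_instantiation (TG : graph) (T : tgraph TG) (C0 C1 : tgraph TG)
    (a : tmor C0 C1) (S : subgraph T) (mu0 : instantiation C0 S) :=
  MorInstantiation {
  mi_cod : instantiation C1 S;
  mi_mor : @hom (Sub T) (inst_im mu0) (inst_im mi_cod);
  mi_j : tcmp (incl mi_mor) (inst_j mu0) = tcmp (inst_j mi_cod) a;
  mi_incl : @cmp (Sub T) _ _ _ (inst_incl mi_cod) mi_mor = inst_incl mu0
}.

Section Finiteness.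

Lemma finite_setT_inj (X : Type) (I : finType) (f : X -> I) :
  injective f -> finite_set [set: X].
Proof.
move=> fi; rewrite -(preimage_setT f); apply: finite_preimage.
  by move=> x y _ _; apply: fi.
exact: finite_finset.
Qed.

Lemma finite_setT_ord (X : Type) :
  finite_set [set: X] -> exists n (f : X -> 'I_n), injective f.
Proof.
move=> /finite_setP[n]; rewrite card_eq_le => /andP[/card_leP[f] _].
exists n, (fun x => Ordinal (set_mem (valP (f (to_setT x))))) => x y [] /val_inj.
by move=> /(@inj _ _ _ f); rewrite !in_setT => /(_ isT isT) /(congr1 val).
Qed.

Lemma iso_injective (TG : graph) (G H : tgraph TG) (f : tmor G H) :
  @iso (GraphTG TG) G H f -> gmor_injective f.
Proof.
move=> [k kf _]; apply/(@monoE TG G H f) => X u v fuv.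
by rewrite -(cmp_idl u) -(cmp_idl v) -kf -!cmp_assoc fuv.
Qed.

Lemma finite_instantiation (TG : graph) (T : tgraph TG) (C : tgraph TG)
    (S : subgraph T) :
  finite_graph T -> finite_set [set: instantiation C S].
Proof.
move=> [/finite_setT_ord[n [f fi]] /finite_setT_ord[m [h hi]]].
have [[mu]|no] := pselect (inhabited (instantiation C S)); last first.
  have -> : [set: instantiation C S] = set0.
    by apply/seteqP; split=> // mu _; case: no; split.
  exact: finite_set0.
have [jn je] := iso_injective (inst_iso mu).
pose fC x := f (val (nmap (inst_j mu) x)).
pose hC x := h (val (emap (inst_j mu) x)).
have fCi : injective fC by move=> x y /fi/val_inj/jn.
have hCi : injective hC by move=> x y /hi/val_inj/je.
pose code (nu : instantiation C S) :=
  ([set i | `[< exists2 x, snode (inst_im nu) x & i = f x >]],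
   [set i | `[< exists2 x, sedge (inst_im nu) x & i = h x >]],
   [set p | `[< exists x, p = (fC x, f (val (nmap (inst_j nu) x))) >]],
   [set p | `[< exists x, p = (hC x, h (val (emap (inst_j nu) x))) >]])%SET.
apply: (@finite_setT_inj _ _ code) => -[B1 j1 i1 s1] [B2 j2 i2 s2] [].
move=> /= /setP En /setP Ee /setP Ejn /setP Eje.
have EB : B1 = B2.
  apply: subgraph_eq; apply/seteqP; split=> x Bx.
  - have := En (f x); rewrite !inE => E.
    have : `[< exists2 y, snode B1 y & f x = f y >] by apply/asboolP; exists x.
    by rewrite E => /asboolP[y By /fi ->].
  - have := En (f x); rewrite !inE => E.
    have : `[< exists2 y, snode B2 y & f x = f y >] by apply/asboolP; exists x.
    by rewrite -E => /asboolP[y By /fi ->].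
  - have := Ee (h x); rewrite !inE => E.
    have : `[< exists2 y, sedge B1 y & h x = h y >] by apply/asboolP; exists x.
    by rewrite E => /asboolP[y By /hi ->].
  - have := Ee (h x); rewrite !inE => E.
    have : `[< exists2 y, sedge B2 y & h x = h y >] by apply/asboolP; exists x.
    by rewrite -E => /asboolP[y By /hi ->].
subst B2; have Ej : j1 = j2.
  apply: tmor_eq => x; apply: val_inj.
  - have := Ejn (fC x, f (val (nmap j1 x))); rewrite !inE => E.
    have : `[< exists y, (fC x, f (val (nmap j1 x)))
                       = (fC y, f (val (nmap j1 y))) >].
      by apply/asboolP; exists x.
    by rewrite E => /asboolP[y [/fCi -> /fi]].
  - have := Eje (hC x, h (val (emap j1 x))); rewrite !inE => E.
    have : `[< exists y, (hC x, h (val (emap j1 x)))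
                       = (hC y, h (val (emap j1 y))) >].
      by apply/asboolP; exists x.
    by rewrite E => /asboolP[y [/hCi -> /hi]].
have Es : s1 = s2 := @Prop_irrelevance (subg _ _) s1 s2.
by subst j2 s2; rewrite (Prop_irrelevance i1 i2).
Qed.

Lemma mi_cod_inj (TG : graph) (T : tgraph TG) (C0 C1 : tgraph TG)
    (a : tmor C0 C1) (S : subgraph T) (mu0 : instantiation C0 S) :
  injective (@mi_cod TG T C0 C1 a S mu0).
Proof.
move=> [nu1 b1 j1 i1] [nu2 b2 j2 i2] /= E; subst nu2.
have Eb : b1 = b2 := @Prop_irrelevance (subg _ _) b1 b2.
by subst b2; congr MorInstantiation; apply: Prop_irrelevance.
Qed.

Lemma finite_mor_instantiation (TG : graph) (T : tgraph TG)
    (C0 C1 : tgraph TG) (a : tmor C0 C1) (S : subgraph T)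
    (mu0 : instantiation C0 S) :
  finite_graph T -> finite_set [set: mor_instantiation a mu0].
Proof.
move=> Tfin; rewrite -(preimage_setT (@mi_cod TG T C0 C1 a S mu0)).
apply: finite_preimage; last exact: finite_instantiation.
by move=> x y _ _; apply: mi_cod_inj.
Qed.

End Finiteness.

(* The instantiations of [a] with domain [mu0], each listed once; [fset_set]
   needs a [choiceType], whence [{classic _}].  The listing is only meaningful
   for finite [T] (see [finite_mor_instantiation]): [fset_set] of an infinite
   set is empty. *)
Definition mor_instantiations (TG : graph) (T : tgraph TG) (C0 C1 : tgraph TG)
    (a : tmor C0 C1) (mu0 : instantiation C0 (whole T)) :
    seq (mor_instantiation a mu0) :=
  fset_set [set: {classic mor_instantiation a mu0}].

(* [InstPol true c mu0] is Inst(c, mu0) and [InstPol false c mu0] is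
   Inst(not c, mu0): the polarity makes the recursion, which pushes negations
   inwards, structural.  The equations of the recursion are
   [Inst_true], ..., [Inst_not_ex] below. *)
Fixpoint InstPol (TG : graph) (T : tgraph TG) (pos : bool)
    (C0 : tgraph TG) (c : @cond (GraphTG TG) C0) :
    forall mu0 : instantiation C0 (whole T), @cond (Sub T) (inst_im mu0) :=
  match c in cond C
  return forall mu0 : instantiation C (whole T), @cond (Sub T) (inst_im mu0)
  with
  | CTrue _ => fun=> if pos then CTrue else CFalse
  | CEx _ C1 a1 _ d => fun mu0 =>
      if pos then
        \big[COr/CFalse]_(b1 <- mor_instantiations a1 mu0)
           CEx (mi_mor b1) (Sub_mono (mi_mor b1)) (InstPol true d (mi_cod b1))
      else
        \big[CAnd/CTrue]_(b1 <- mor_instantiations a1 mu0)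
           COr (CNot (CEx (mi_mor b1) (Sub_mono (mi_mor b1)) CTrue))
               (CEx (mi_mor b1) (Sub_mono (mi_mor b1)) (InstPol false d (mi_cod b1)))
  | CNot _ d => InstPol (~~ pos) d
  | CAnd _ d1 d2 => fun mu0 =>
      (if pos then CAnd else COr) (InstPol pos d1 mu0) (InstPol pos d2 mu0)
  | COr _ d1 d2 => fun mu0 =>
      (if pos then COr else CAnd) (InstPol pos d1 mu0) (InstPol pos d2 mu0)
  end.

Definition Inst (TG : graph) (T : tgraph TG) (C0 : tgraph TG)
    (c : @cond (GraphTG TG) C0) (mu0 : instantiation C0 (whole T)) :
    @cond (Sub T) (inst_im mu0) :=
  InstPol true c mu0.

Section InstEquations.
Variables (TG : graph) (T : tgraph TG) (C0 : tgraph TG).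
Variable mu0 : instantiation C0 (whole T).
Implicit Types d e : @cond (GraphTG TG) C0.

Lemma Inst_true : Inst CTrue mu0 = CTrue. Proof. by []. Qed.

Lemma Inst_and d1 d2 :
  Inst (CAnd d1 d2) mu0 = CAnd (Inst d1 mu0) (Inst d2 mu0).
Proof. by []. Qed.

Lemma Inst_or d1 d2 : Inst (COr d1 d2) mu0 = COr (Inst d1 mu0) (Inst d2 mu0).
Proof. by []. Qed.

Lemma Inst_ex (C1 : tgraph TG) (a1 : @hom (GraphTG TG) C0 C1)
    (a1_mono : mono a1) (d : @cond (GraphTG TG) C1) :
  Inst (CEx a1 a1_mono d) mu0 =
  \big[COr/CFalse]_(b1 <- mor_instantiations a1 mu0)
     CEx (mi_mor b1) (Sub_mono (mi_mor b1)) (Inst d (mi_cod b1)).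
Proof. by []. Qed.

Lemma Inst_not_true : Inst (CNot CTrue) mu0 = CFalse. Proof. by []. Qed.

Lemma Inst_not_and e1 e2 :
  Inst (CNot (CAnd e1 e2)) mu0 = COr (Inst (CNot e1) mu0) (Inst (CNot e2) mu0).
Proof. by []. Qed.

Lemma Inst_not_or e1 e2 :
  Inst (CNot (COr e1 e2)) mu0 = CAnd (Inst (CNot e1) mu0) (Inst (CNot e2) mu0).
Proof. by []. Qed.

Lemma Inst_not_not e : Inst (CNot (CNot e)) mu0 = Inst e mu0.
Proof. by []. Qed.

Lemma Inst_not_ex (C1 : tgraph TG) (a1 : @hom (GraphTG TG) C0 C1)
    (a1_mono : mono a1) (e : @cond (GraphTG TG) C1) :
  Inst (CNot (CEx a1 a1_mono e)) mu0 =
  \big[CAnd/CTrue]_(b1 <- mor_instantiations a1 mu0)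
     COr (CNot (CEx (mi_mor b1) (Sub_mono (mi_mor b1)) CTrue))
         (CEx (mi_mor b1) (Sub_mono (mi_mor b1)) (Inst (CNot e) (mi_cod b1))).
Proof. by []. Qed.

End InstEquations.

Section Image.
Variables (TG : graph) (T : tgraph TG) (C0 : tgraph TG) (S : subgraph T).
Variable g : tmor C0 S.

Program Definition image : subgraph T :=
  @Subgraph TG T (range (fun x => val (nmap g x)))
                 (range (fun e => val (emap g e))) _ _.
Next Obligation.
by move=> _ [e _ <-]; exists (src e); rewrite // gmor_src.
Qed.
Next Obligation.
by move=> _ [e _ <-]; exists (tar e); rewrite // gmor_tar.
Qed.

Program Definition image_m : @hom (Sub T) image S := conj _ _.
Next Obligation. by move=> _ [x _ <-]; exact: set_mem (valP (nmap g x)). Qed.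
Next Obligation. by move=> _ [e _ <-]; exact: set_mem (valP (emap g e)). Qed.

Program Definition image_e : tmor C0 image :=
  @TMor TG C0 image
    (@GMor C0 image
       (fun x => exist _ (val (nmap g x)) (mem_set (imageT _ x)))
       (fun e => exist _ (val (emap g e)) (mem_set (imageT _ e))) _ _) _.
Next Obligation. by move=> e; apply: val_inj; rewrite /= gmor_src. Qed.
Next Obligation. by move=> e; apply: val_inj; rewrite /= gmor_tar. Qed.
Next Obligation. by rewrite -[RHS](tmor_typ g); apply: gmor_eq. Qed.

Lemma image_fact : tcmp (incl image_m) image_e = g.
Proof. by apply: tmor_eq => x; apply: val_inj. Qed.

Hypothesis g_inj : gmor_injective g.

Lemma image_e_iso : @iso (GraphTG TG) C0 image image_e.
Proof.
have [gn ge] := g_inj.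
have n_ex (y : snode image) : exists x, nmap image_e x = y.
  by have [x _ xy] := set_mem (valP y); exists x; apply: val_inj.
have e_ex (y : sedge image) : exists x, emap image_e x = y.
  by have [x _ xy] := set_mem (valP y); exists x; apply: val_inj.
have en_inj : injective (nmap image_e).
  by move=> x y /(congr1 val) /= /val_inj /gn.
have ee_inj : injective (emap image_e).
  by move=> x y /(congr1 val) /= /val_inj /ge.
pose kn y := sval (cid (n_ex y)); pose ke y := sval (cid (e_ex y)).
have knP y : nmap image_e (kn y) = y := svalP (cid (n_ex y)).
have keP y : emap image_e (ke y) = y := svalP (cid (e_ex y)).
have ks (e : edge image) : kn (src e) = src (ke e).
  by apply: en_inj; rewrite knP gmor_src keP.
have kt (e : edge image) : kn (tar e) = tar (ke e).
  by apply: en_inj; rewrite knP gmor_tar keP.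
pose k := @GMor image C0 kn ke ks kt.
have k_typ : gcmp (typ C0) k = typ image.
  rewrite -(tmor_typ image_e).
  by apply: gmor_eq => y /=; rewrite -{2}[y]knP || rewrite -{2}[y]keP.
exists (@TMor TG image C0 k k_typ).
  by apply: tmor_eq => x; [apply: en_inj; apply: knP|apply: ee_inj; apply: keP].
by apply: tmor_eq => y; [apply: knP|apply: keP].
Qed.

Definition inst_of : instantiation C0 S :=
  @Instantiation TG T C0 S image image_e image_e_iso image_m.

End Image.

(* Main.v *)
From mathcomp Require Import all_boot finmap.
From mathcomp Require Import all_classical.
Require Import Defs.

(** A nested condition only ever looks at its graph through the injective
    morphisms [q : C1 -> S] that extend a given [g : C0 -> S] along
    [a1 : C0 -> C1].  Replacing such a [q] by its image factorization turns it
    into an instantiation of [a1] whose codomain has its image inside [S]; in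
    the other direction, the isomorphism of an instantiation followed by the
    inclusion of its image in [S] is such a [q].  This correspondence,
    [exists_extensionE], makes the existential quantifier of the condition and
    the quantification over instantiations in the instantiated condition range
    over the same things.

    The instantiated condition lists all instantiations in [T], also those
    whose image does not fit into [S].  In a disjunction these are harmless,
    because no inclusion into [S] witnesses their disjunct.  In the conjunction
    that expresses a negated existential they are neutralized by the disjunct
    that says that [B1] is not contained in [S].  If [B1] is contained in [S],
    the inclusion is unique, so an existential and a universal statement about
    it agree.  Finiteness of [T] makes the listing complete
    ([mem_mor_instantiations]).

    The theorem follows by induction on the condition.  Two generalizations
    make the induction go through ([sat_InstPol]): both polarities are treated
    together, since negation exchanges them; and the image factorization of
    [g] is replaced by any factorization of [g] into an instantiation in [T]
    followed by an inclusion into [S], which is what one has below a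
    quantifier. *)

Set Implicit Arguments.
Unset Strict Implicit.
Unset Printing Implicit Defensive.

Section Satisfaction.
Variables (D : category) (A G : D) (g : hom A G).

Lemma sat_bigor (I : eqType) (s : seq I) (F : I -> cond A) :
  sat (\big[COr/CFalse]_(i <- s) F i) g <-> exists2 i, i \in s & sat (F i) g.
Proof.
elim: s => [|i s IHs]; first by rewrite big_nil; split=> [[]|[]].
rewrite big_cons /=; split=> [[Fi|/IHs[k ks Fk]]|[k]].
- by exists i; rewrite // inE eqxx.
- by exists k; rewrite // inE ks orbT.
- by rewrite inE => /orP[/eqP->|ks Fk]; [left|right; apply/IHs; exists k].
Qed.

Lemma sat_bigand (I : eqType) (s : seq I) (F : I -> cond A) :
  sat (\big[CAnd/CTrue]_(i <- s) F i) g <-> forall i, i \in s -> sat (F i) g.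
Proof.
elim: s => [|i s IHs]; first by rewrite big_nil.
rewrite big_cons /=; split=> [[Fi /IHs Fs] k|Fs].
  by rewrite inE => /orP[/eqP->|/Fs].
split; first by apply: Fs; rewrite inE eqxx.
by apply/IHs => k ks; apply: Fs; rewrite inE ks orbT.
Qed.

End Satisfaction.

Lemma mem_mor_instantiations (TG : graph) (T : tgraph TG)
    (T_finite : finite_graph T) (C0 C1 : tgraph TG) (a : tmor C0 C1)
    (mu0 : instantiation C0 (whole T))
    (b : {classic mor_instantiation a mu0}) :
  b \in (mor_instantiations a mu0 : seq {classic _}).
Proof.
by rewrite in_fset_set ?in_setT //; apply: finite_mor_instantiation.
Qed.

(** In [Sub T] an inclusion [A <= S] factors through [b : A <= B] as soon as
    [B <= S], and every morphism is a monomorphism: only [B <= S] remains of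
    the requirements on a witness. *)
Lemma sat_CEx_Sub (TG : graph) (T : tgraph TG) (A B S : Sub T) (b : hom A B)
    (d : cond B) (m : hom A S) :
  sat (CEx b (Sub_mono b) d) m <-> exists m1 : hom B S, sat d m1.
Proof.
split=> [[m1 [_ _ dm1]]|[m1 dm1]]; exists m1 => //.
by split=> //; [exact: Sub_mono|exact: (@Prop_irrelevance (subg A S))].
Qed.

(** An instantiation in [T] whose image lies in [S], read as a morphism to
    [S]. *)
Definition inst_mor (TG : graph) (T : tgraph TG) (C : tgraph TG)
    (S : subgraph T) (mu : instantiation C (whole T))
    (m : @hom (Sub T) (inst_im mu) S) : tmor C S :=
  tcmp (incl m) (inst_j mu).

Section Extensions.
Variables (TG : graph) (T : tgraph TG) (S : subgraph T).

Lemma mono_inst_mor (C : tgraph TG) (mu : instantiation C (whole T))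
    (m : @hom (Sub T) (inst_im mu) S) : @mono (GraphTG TG) C S (inst_mor m).
Proof.
have [jn je] := iso_injective (inst_iso mu).
apply/(@monoE TG C S); split=> x y /(congr1 val) /= /val_inj.
- exact: jn.
- exact: je.
Qed.

Variables (C0 C1 : tgraph TG) (a : tmor C0 C1).
Variables (mu0 : instantiation C0 (whole T)).
Variable m : @hom (Sub T) (inst_im mu0) S.

Lemma inst_mor_cod (b : mor_instantiation a mu0)
    (m1 : @hom (Sub T) (inst_im (mi_cod b)) S) :
  inst_mor m = tcmp (inst_mor m1) a.
Proof.
apply: tmor_eq => x; apply: val_inj.
- exact: (congr1 (fun h : tmor C0 (inst_im (mi_cod b)) => val (nmap h x))
                 (mi_j b)).
- exact: (congr1 (fun h : tmor C0 (inst_im (mi_cod b)) => val (emap h x))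
                 (mi_j b)).
Qed.

Section ExtensionInstantiation.
Variables (q : tmor C1 S) (q_inj : gmor_injective q).
Hypothesis mqa : inst_mor m = tcmp q a.

(** Every element of the image of [mu0] comes from [C0] because [inst_j mu0]
    is onto; pushed along [a], it provides a preimage under [q]. *)
Lemma inst_im_sub_image : subg (inst_im mu0) (image q).
Proof.
have [k _ jk] := inst_iso mu0.
split=> x /mem_set x_im.
- pose y : node (inst_im mu0) := exist _ x x_im.
  pose z : node C0 := nmap (k : tmor (inst_im mu0) C0) y.
  exists (nmap a z) => //.
  have /= <- := congr1 (fun h : tmor C0 S => val (nmap h z)) mqa.
  exact: (congr1 (fun h : tmor (inst_im mu0) (inst_im mu0) => val (nmap h y))
                 jk).
- pose y : edge (inst_im mu0) := exist _ x x_im.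
  pose z : edge C0 := emap (k : tmor (inst_im mu0) C0) y.
  exists (emap a z) => //.
  have /= <- := congr1 (fun h : tmor C0 S => val (emap h z)) mqa.
  exact: (congr1 (fun h : tmor (inst_im mu0) (inst_im mu0) => val (emap h y))
                 jk).
Qed.

Lemma inst_im_sub_image_j :
  tcmp (@incl TG T _ _ inst_im_sub_image) (inst_j mu0) =
  tcmp (inst_j (inst_whole (inst_of q_inj))) a.
Proof.
apply: tmor_eq => x; apply: val_inj.
- exact: (congr1 (fun h : tmor C0 S => val (nmap h x)) mqa).
- exact: (congr1 (fun h : tmor C0 S => val (emap h x)) mqa).
Qed.

Definition mor_inst_of : mor_instantiation a mu0 :=
  @MorInstantiation TG T C0 C1 a (whole T) mu0 (inst_whole (inst_of q_inj))
    inst_im_sub_image inst_im_sub_image_j (@Prop_irrelevance (subg _ _) _ _).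

End ExtensionInstantiation.

(** From left to right, the image factorization of [q] gives the instantiation
    and recomposes to [q] by [image_fact]; from right to left, the morphism
    read off is injective because [inst_j] is an isomorphism. *)
Lemma exists_extensionE (P : tmor C1 S -> Prop) :
  (exists q : tmor C1 S,
     [/\ @mono (GraphTG TG) C1 S q, inst_mor m = tcmp q a & P q]) <->
  exists (b : mor_instantiation a mu0)
    (m1 : @hom (Sub T) (inst_im (mi_cod b)) S), P (inst_mor m1).
Proof.
split=> [[q [/(@monoE TG C1 S) q_inj mqa Pq]]|[b [m1 Pm1]]].
  exists (mor_inst_of q_inj mqa), (image_m q).
  by rewrite /inst_mor /= image_fact.
exists (inst_mor m1); split=> //; first exact: mono_inst_mor.
exact: inst_mor_cod.
Qed.

End Extensions.

(** The case that needs an argument is a negated existential.  Its conjunct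
    for an instantiation [b] says that either no inclusion of the image of the
    codomain in [S] exists, or one exists that refutes [d].  As there is at
    most one such inclusion, this means that every such inclusion refutes [d],
    which is what the negation of [exists_extensionE] asks for. *)
Lemma sat_InstPol (TG : graph) (T : tgraph TG) (T_finite : finite_graph T)
    (S : subgraph T) (pos : bool) (C0 : tgraph TG)
    (c : @cond (GraphTG TG) C0) (mu0 : instantiation C0 (whole T))
    (m : @hom (Sub T) (inst_im mu0) S) :
  @sat (Sub T) (inst_im mu0) (InstPol pos c mu0) S m <->
  if pos then @sat (GraphTG TG) C0 c S (inst_mor m)
  else ~ @sat (GraphTG TG) C0 c S (inst_mor m).
Proof.
elim: c => [{}C0|{}C0 C1 a a_mono d IHd|{}C0 d IHd
           |{}C0 d1 IH1 d2 IH2|{}C0 d1 IH1 d2 IH2] in pos mu0 m *.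
- by case: pos.
- have exE := exists_extensionE a m (@sat (GraphTG TG) C1 d S).
  case: pos.
    apply: (iff_trans (@sat_bigor _ _ _ _ {classic _} _ _)).
    apply: iff_trans _ (iff_sym exE).
    split=> [[b _ /sat_CEx_Sub[m1 /IHd dm1]]|[b [m1 dm1]]].
      by exists b, m1.
    exists b; first exact: mem_mor_instantiations.
    by apply/sat_CEx_Sub; exists m1; apply/IHd.
  have conjunctE (b : mor_instantiation a mu0) :
      ~ sat (CEx (mi_mor b) (Sub_mono (mi_mor b)) CTrue) m \/
      sat (CEx (mi_mor b) (Sub_mono (mi_mor b)) (InstPol false d (mi_cod b))) m
      <->
      forall m1, ~ @sat (GraphTG TG) C1 d S (@inst_mor _ _ _ _ (mi_cod b) m1).
    split=> [[no_m1 m1 _|/sat_CEx_Sub[m1' /IHd dm1'] m1]|no_dm1].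
    - by apply: no_m1; apply/sat_CEx_Sub; exists m1.
    - by rewrite (@Prop_irrelevance (subg _ _) m1 m1').
    have [m1|no_m1] := pselect (subg (inst_im (mi_cod b)) S).
      by right; apply/sat_CEx_Sub; exists m1; apply/IHd/no_dm1.
    by left=> /sat_CEx_Sub[].
  apply: (iff_trans (@sat_bigand _ _ _ _ {classic _} _ _)).
  apply: iff_trans _ (not_iff_compat (iff_sym exE)).
  split=> [all_b [b [m1 dm1]]|no_b b _].
    have /conjunctE no_dm1 := all_b b (mem_mor_instantiations T_finite b).
    exact: no_dm1 dm1.
  by apply/conjunctE => m1 dm1; apply: no_b; exists b, m1.
- rewrite /= IHd; case: pos => //=.
  by split=> [dm /(_ dm)|/contrapT].
- by case: pos; rewrite /= IH1 IH2 ?not_andP.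
- by case: pos; rewrite /= IH1 IH2 ?not_orP.
Qed.

Theorem theorem8 (TG : graph) (T : tgraph TG) (T_finite : finite_graph T)
    (C0 : tgraph TG) (c : @cond (GraphTG TG) C0)
    (S : subgraph T) (g : tmor C0 S) (g_inj : gmor_injective g) :
  @sat (GraphTG TG) C0 c S g <->
  @sat (Sub T) (image g) (Inst c (inst_whole (inst_of g_inj))) S (image_m g).
Proof.
rewrite (sat_InstPol T_finite true c (mu0 := inst_whole (inst_of g_inj))).
by rewrite /inst_mor /= image_fact.
Qed.
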